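(* Let $B=\mathcal{O}_q(G/L_S)$ be an irreducible quantum flag manifold, let $k\in\mathbb{Z}$, and let $\sigma_k\colon\mathcal{E}_k\otimes_B\Omega^{(0,1)}_q(G/L_S)\to\Omega^{(0,1)}_q(G/L_S)\otimes_B\mathcal{E}_k$ be the bimodule map associated to the connection $\overline{\partial}_{\mathcal{E}_k}$. Let $\theta\in\mathbb{C}$ be the nonzero scalar (independent of $k$) such that $\Phi(\sigma_k)([e]\otimes[\omega])=\theta^k[\omega]\otimes[e]$ for all $k\in\mathbb{Z}$, $e\in\mathcal{E}_k$, $\omega\in\Omega^{(0,1)}_q(G/L_S)$. Then for any $b\in B$ and $e\in\mathcal{E}_k$, $$\sigma_k(e\otimes\overline{\partial}b)=\theta^k\,e_{(-2)}b_{(1)}S(e_{(-1)})S(b_{(2)})\,\overline{\partial}b_{(3)}\otimes e_{(0)}.$$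
   Context: **Connections.** A first-order differential calculus (fodc) over an algebra $B$ is a pair $(\Omega^1(B),\mathrm{d})$ with $\Omega^1(B)$ a $B$-bimodule and $\mathrm{d}\colon B\to\Omega^1(B)$ a derivation such that $\Omega^1(B)$ is generated as a left $B$-module by $\mathrm{d}B$. The restriction of a fodc over $P$ to a subalgebra $B$ is the sub-calculus over $B$ generated by $\mathrm{d}b$, $b\in B$. A left connection on a left $B$-module $\mathcal{F}$ is a linear map $\nabla\colon\mathcal{F}\to\Omega^1(B)\otimes_B\mathcal{F}$ with $\nabla(bf)=\mathrm{d}b\otimes f+b\nabla f$. If $\mathcal{F}$ is a $B$-bimodule, $\nabla$ is a bimodule connection if there is a $B$-bimodule map $\sigma\colon\mathcal{F}\otimes_B\Omega^1(B)\to\Omega^1(B)\otimes_B\mathcal{F}$ with $\sigma(f\otimes\mathrm{d}b)=\nabla(fb)-\nabla(f)b$; $\sigma$ is the associated bimodule map. **Quantum groups.** $\mathfrak{g}$ is a finite-dimensional complex simple Lie algebra with simple roots $\alpha_1,\dots,\alpha_l$, Cartan matrix $(a_{ij})$, fundamental weights $\varpi_1,\dots,\varpi_l$, form normalised so that short simple roots satisfy $(\alpha_i,\alpha_i)=2$; $q\in\mathbb{R}\setminus\{-1,0,1\}$, $q_i=q^{(\alpha_i,\alpha_i)/2}$. $U_q(\mathfrak{g})$ is the Drinfeld--Jimbo Hopf algebra with generators $E_i,F_i,K_i^{\pm1}$, relations $K_iE_j=q_i^{a_{ij}}E_jK_i$, $K_iF_j=q_i^{-a_{ij}}F_jK_i$,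 $K_iK_j=K_jK_i$, $E_iF_j-F_jE_i=\delta_{ij}(K_i-K_i^{-1})/(q_i-q_i^{-1})$ and the quantum Serre relations, coproduct $\Delta K_i=K_i\otimes K_i$, $\Delta E_i=E_i\otimes K_i+1\otimes E_i$, $\Delta F_i=F_i\otimes1+K_i^{-1}\otimes F_i$, and $\varepsilon(E_i)=\varepsilon(F_i)=0$, $\varepsilon(K_i)=1$. $V_\lambda$ is the irreducible type-1 module of dominant highest weight $\lambda$. $\mathcal{O}_q(G)\subseteq U_q(\mathfrak{g})^\circ$ is the Hopf subalgebra generated by the coordinate functions $c^V_{f,v}(X)=f(Xv)$, $V$ a type-1 module, $v\in V$, $f\in V^*$; $S$ also denotes its antipode. $U_q(\mathfrak{g})$ acts on it by $X\triangleright c^V_{f,v}=c^V_{f,Xv}$. **Irreducible quantum flag manifolds.** Let $\alpha_x$ be a simple root with coefficient $1$ in the highest root of $\mathfrak{g}$ and $S=\{\alpha_1,\dots,\alpha_l\}\setminus\{\alpha_x\}$. Let $U_q(\mathfrak{l}_S)\subseteq U_q(\mathfrak{g})$ be generated by all $K_i^{\pm1}$ and by $E_s,F_s$, $s\in S$, and $U_q(\mathfrak{l}_S^{\mathrm{s}})$ by $K_s^{\pm1},E_s,F_s$, $s\in S$. The irreducible quantum flag manifold $B=\mathcal{O}_q(G/L_S)$ and the quantum Poisson homogeneous space $\mathcal{O}_q(G/L_S^{\mathrm{s}})$ are the subalgebras of $\mathcal{O}_q(G)$ of elements $a$ with $X\triangleright a=\varepsilon(X)a$ for all $X\in U_q(\mathfrak{l}_S)$,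 resp. $X\in U_q(\mathfrak{l}^{\mathrm{s}}_S)$. Both are left $\mathcal{O}_q(G)$-comodule algebras via $\Delta$. Let $\{v_i\}_{i=1}^N$ be a weight basis of $V_{\varpi_x}$ with $v_N$ a highest weight vector and $\{f_i\}$ the dual basis of the dual module $V_{-w_0(\varpi_x)}$. Then $\mathcal{O}_q(G/L_S^{\mathrm{s}})$ is generated by $z_i=c^{V_{\varpi_x}}_{f_i,v_N}$ and $\overline{z}_j=c^{V_{-w_0(\varpi_x)}}_{v_j,f_N}$, and it has a strong $\mathbb{Z}$-algebra grading $\mathcal{O}_q(G/L_S^{\mathrm{s}})=\bigoplus_{k\in\mathbb{Z}}\mathcal{E}_k$ determined by $\deg z_i=1$, $\deg\overline{z}_j=-1$ (equivalently a right $\mathcal{O}(U_1)$-comodule algebra structure, $\mathcal{O}(U_1)$ the Laurent polynomial Hopf algebra). One has $\mathcal{E}_0=B$; each $\mathcal{E}_k$ is a $B$-bimodule and left $\mathcal{O}_q(G)$-subcomodule, called a relative line module. **Heckenberger--Kolb calculi.** A fodc over $B$ (or over $\mathcal{O}_q(G/L^{\mathrm{s}}_S)$) is left $\mathcal{O}_q(G)$-covariant if $b\,\mathrm{d}b'\mapsto b_{(1)}b'_{(1)}\otimes b_{(2)}\mathrm{d}b'_{(2)}$ is a well-defined left coaction on it; a covariant connection is one that is a left comodule map. Up to isomorphism there are exactly two finite-dimensional irreducible left $\mathcal{O}_q(G)$-covariant fodc over $B$ (irreducible: nonzero with no proper nonzero covariant sub-bimodule; finite-dimensional: $\Omega^1/B^+\Omega^1$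 finite-dimensional, $B^+=B\cap\ker\varepsilon$), and $(\Omega^{(0,1)}_q(G/L_S),\overline{\partial})$ denotes the one that is the restriction of a left $\mathcal{O}_q(G)$-covariant, right $\mathcal{O}(U_1)$-covariant fodc over $\mathcal{O}_q(G/L_S^{\mathrm{s}})$ with $\overline{\partial}z_i=0$ for all $i$. It is known that each $\mathcal{E}_k$, $k\in\mathbb{Z}$, admits a unique left $\mathcal{O}_q(G)$-covariant connection $\overline{\partial}_{\mathcal{E}_k}\colon\mathcal{E}_k\to\Omega^{(0,1)}_q(G/L_S)\otimes_B\mathcal{E}_k$; it is a bimodule connection, and its associated bimodule map $\sigma_k$ is a left $\mathcal{O}_q(G)$-comodule isomorphism. **Takeuchi's functor.** Consider left $\mathcal{O}_q(G)$-comodules $\mathcal{F}$ with a compatible $B$-bimodule structure ($\Delta_L(bfb')=\Delta_L(b)\Delta_L(f)\Delta_L(b')$) satisfying $\mathcal{F}B^+=B^+\mathcal{F}$; morphisms are comodule and bimodule maps. Both $\mathcal{E}_k$ and $\Omega^{(0,1)}_q(G/L_S)$ are such objects. Put $\Phi(\mathcal{F})=\mathcal{F}/B^+\mathcal{F}$, with $[f]$ the coset of $f$, a left comodule over $\mathcal{O}_q(L_S)=\mathcal{O}_q(G)/B^+\mathcal{O}_q(G)$ via $[f]\mapsto\pi_S(f_{(-1)})\otimes[f_{(0)}]$; morphisms descend to quotients. $\Phi$ is a monoidal equivalence onto left $\mathcal{O}_q(L_S)$-comodules, and $\Phi(\mathcal{F}\otimes_B\mathcal{G})$ is identified with $\Phi(\mathcal{F})\otimes\Phi(\mathcal{G})$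 by $[f\otimes g]\leftrightarrow[f]\otimes[g]$. The existence of the scalar $\theta$ in the statement is known. **Notation.** Sweedler notation: $\Delta_L(e)=e_{(-1)}\otimes e_{(0)}$ for the left $\mathcal{O}_q(G)$-coaction on $\mathcal{E}_k$, iterated as $e_{(-2)}\otimes e_{(-1)}\otimes e_{(0)}$; for $b\in B$, $b_{(1)}\otimes b_{(2)}\otimes b_{(3)}\in\mathcal{O}_q(G)\otimes\mathcal{O}_q(G)\otimes B$. The right-hand side of the formula has coefficients $e_{(-2)}b_{(1)}S(e_{(-1)})S(b_{(2)})\in\mathcal{O}_q(G)$ and is read in $\mathcal{O}_q(G)\otimes_B\Omega^{(0,1)}_q(G/L_S)\otimes_B\mathcal{E}_k$, into which $\Omega^{(0,1)}_q(G/L_S)\otimes_B\mathcal{E}_k$ embeds via $x\mapsto1\otimes x$ because $\mathcal{O}_q(G)$ is faithfully flat as a right $B$-module. *)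

(* Defs.v *)
From HB Require Import structures.
From mathcomp Require Import all_boot all_order all_algebra.
From mathcomp Require Import generic_quotient complex boolp reals.

Set Implicit Arguments.
Unset Strict Implicit.
Unset Printing Implicit Defensive.

Import Order.TTheory GRing.Theory Num.Theory.
Local Open Scope ring_scope.
Local Open Scope quotient_scope.

(* The tensor product of two vector spaces over K, balanced over a set T
   acting on the right of M (by ra) and on the left of N (by la).  It is the
   quotient of the formal sums [:: (m1, n1); ...; (mr, nr)] by the relation
   of having the same image under every balanced K-bilinear map; the
   universal property is given by tlift_pure and tlift_linear.  With T := K
   it is the tensor product over K, and with T a K-algebra B it is the
   tensor product over B of a right and a left B-module. *)
Section Tensor.
Variables (K : fieldType) (M N : lmodType K) (T : Type).
Variables (ra : M -> T -> M) (la : T -> N -> N).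

Definition balanced (V : lmodType K) (f : M -> N -> V) : Prop :=
  [/\ forall n, linear (f^~ n), forall m, linear (f m)
    & forall m t n, f (ra m t) n = f m (la t n)].

Definition sum_over (V : lmodType K) (f : M -> N -> V) (s : seq (M * N)) : V :=
  \sum_(p <- s) f p.1 p.2.

Definition tens_rel (s s' : seq (M * N)) : bool :=
  `[< forall (V : lmodType K) (f : M -> N -> V),
        balanced f -> sum_over f s = sum_over f s' >].

Lemma tens_rel_refl : reflexive tens_rel.
Proof. by move=> s; apply/asboolP. Qed.

Lemma tens_rel_sym : symmetric tens_rel.
Proof.
by move=> s s'; apply/asboolP/asboolP => h V f hf; rewrite (h V f hf).
Qed.

Lemma tens_rel_trans : transitive tens_rel.
Proof.
move=> s s' s'' /asboolP h /asboolP h'; apply/asboolP => V f hf.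
by rewrite (h V f hf) (h' V f hf).
Qed.

Canonical tens_equiv :=
  EquivRel tens_rel tens_rel_refl tens_rel_sym tens_rel_trans.

Definition tens : Type := {eq_quot tens_equiv}.
HB.instance Definition _ := Choice.on tens.
HB.instance Definition _ := Quotient.on tens.
HB.instance Definition _ := EqQuotient.on tens.

(* The linear map m (x) n |-> f m n; meaningful when f is balanced. *)
Definition tlift (V : lmodType K) (f : M -> N -> V) (t : tens) : V :=
  sum_over f (repr t).

Lemma tens_eqP (s s' : seq (M * N)) :
  (forall (V : lmodType K) (f : M -> N -> V),
     balanced f -> sum_over f s = sum_over f s') ->
  \pi_tens s = \pi_tens s'.
Proof. by move=> h; apply/eqmodP/asboolP. Qed.

Lemma tlift_pi (V : lmodType K) (f : M -> N -> V) s :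
  balanced f -> tlift f (\pi_tens s) = sum_over f s.
Proof.
move=> hf; have /eqmodP/asboolP h : repr (\pi_tens s) = s %[mod tens].
  by rewrite reprK.
exact: h.
Qed.

Lemma sum_over_cat (V : lmodType K) (f : M -> N -> V) s s' :
  sum_over f (s ++ s') = sum_over f s + sum_over f s'.
Proof. by rewrite /sum_over big_cat. Qed.

Definition scale_seq (c : K) (s : seq (M * N)) := [seq (c *: p.1, p.2) | p <- s].

Lemma sum_over_scale (V : lmodType K) (f : M -> N -> V) c s :
  balanced f -> sum_over f (scale_seq c s) = c *: sum_over f s.
Proof.
case=> hl _ _; rewrite /sum_over big_map scaler_sumr; apply: eq_bigr => p _ /=.
have h0 : f 0 p.2 = 0.
  by have := hl p.2 (-1) 0 0; rewrite scaler0 addr0 scaleN1r addNr.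
by have := hl p.2 c p.1 0; rewrite /= addr0 h0 addr0.
Qed.

Definition tens_zero : tens := \pi_tens [::].
Definition tens_add (t t' : tens) : tens := \pi_tens (repr t ++ repr t').
Definition tens_scale (c : K) (t : tens) : tens :=
  \pi_tens (scale_seq c (repr t)).
Definition tens_opp (t : tens) : tens := tens_scale (-1) t.

Lemma tensP (t t' : tens) :
  (forall (V : lmodType K) (f : M -> N -> V),
     balanced f -> tlift f t = tlift f t') -> t = t'.
Proof. by move=> h; rewrite -[t]reprK -[t']reprK; apply: tens_eqP. Qed.

Lemma tlift0 (V : lmodType K) (f : M -> N -> V) : balanced f -> tlift f tens_zero = 0.
Proof. by move=> hf; rewrite tlift_pi // /sum_over big_nil. Qed.
Lemma tliftD (V : lmodType K) (f : M -> N -> V) t t' : balanced f ->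
  tlift f (tens_add t t') = tlift f t + tlift f t'.
Proof. by move=> hf; rewrite tlift_pi // sum_over_cat. Qed.
Lemma tliftZ (V : lmodType K) (f : M -> N -> V) c t : balanced f ->
  tlift f (tens_scale c t) = c *: tlift f t.
Proof. by move=> hf; rewrite tlift_pi // sum_over_scale. Qed.

Let E := (tlift0, tliftD, tliftZ).

Lemma tens_addA : associative tens_add.
Proof. by move=> a b c; apply: tensP => V f hf; rewrite !E ?addrA. Qed.
Lemma tens_addC : commutative tens_add.
Proof. by move=> a b; apply: tensP => V f hf; rewrite !E 1?addrC. Qed.
Lemma tens_add0 : left_id tens_zero tens_add.
Proof. by move=> a; apply: tensP => V f hf; rewrite !E ?add0r. Qed.
Lemma tens_addN : left_inverse tens_zero tens_opp tens_add.
Proof.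
by move=> a; apply: tensP => V f hf; rewrite !E // scaleN1r addNr.
Qed.
HB.instance Definition _ :=
  GRing.isZmodule.Build tens tens_addA tens_addC tens_add0 tens_addN.

Lemma tens_scaleA a b t : tens_scale a (tens_scale b t) = tens_scale (a * b) t.
Proof. by apply: tensP => V f hf; rewrite !E // scalerA. Qed.
Lemma tens_scale1 : left_id 1 tens_scale.
Proof. by move=> t; apply: tensP => V f hf; rewrite !E // scale1r. Qed.
Lemma tens_scaleDr : right_distributive tens_scale +%R.
Proof.
move=> a t t'; apply: tensP => V f hf.
by rewrite ![in RHS]E // tliftZ // [tlift f (t + t')]tliftD // scalerDr.
Qed.
Lemma tens_scaleDl t : {morph tens_scale^~ t : a b / a + b}.
Proof.
move=> a b; apply: tensP => V f hf.
by rewrite [RHS]tliftD // !tliftZ // scalerDl.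
Qed.
HB.instance Definition _ := GRing.Zmodule_isLmodule.Build K tens
  tens_scaleA tens_scale1 tens_scaleDr tens_scaleDl.

Definition tpure (m : M) (n : N) : tens := \pi_tens [:: (m, n)].

Lemma tlift_pure (V : lmodType K) (f : M -> N -> V) m n :
  balanced f -> tlift f (tpure m n) = f m n.
Proof. by move=> hf; rewrite tlift_pi // /sum_over big_seq1. Qed.

Lemma tlift_linear (V : lmodType K) (f : M -> N -> V) : balanced f -> linear (tlift f).
Proof. by move=> hf c t t'; rewrite [LHS]tliftD // tliftZ. Qed.

Lemma tpure_balanced : balanced tpure.
Proof.
have pl (V : lmodType K) (f : M -> N -> V) m n c t : balanced f ->
    tlift f (c *: tpure m n + t) = c *: f m n + tlift f t.
  by move=> hf; rewrite [LHS]tliftD // tliftZ // tlift_pure.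
split=> [n c m m' | m c n n' | m t n]; apply: tensP => V f hf;
  rewrite ?pl ?tlift_pure //; case: (hf) => [hl hr hm]; first exact: hl.
- exact: hr.
- exact: hm.
Qed.

Lemma tens_pureE (t : tens) : t = \sum_(p <- repr t) tpure p.1 p.2.
Proof.
apply: tensP => V f hf; rewrite {1}/tlift /sum_over.
elim: (repr t) => [|p s IH]; first by rewrite !big_nil [RHS]tlift0.
by rewrite !big_cons [RHS]tliftD // tlift_pure // IH.
Qed.

Lemma tens_ind (P : tens -> Prop) :
  P 0 -> (forall m n t, P t -> P (tpure m n + t)) -> forall t, P t.
Proof.
move=> P0 PD t; rewrite [t]tens_pureE.
by elim: (repr t) => [|p s IH]; rewrite ?big_nil ?big_cons //; apply: PD.
Qed.

End Tensor.
Arguments tens {K M N T} ra la.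
Arguments tpure {K M N T ra la} m n.
Arguments tlift {K M N T ra la V} f t.

Notation "m ⊙ n" := (tpure m n) (at level 40, left associativity) : ring_scope.

Definition tensK (K : fieldType) (M N : lmodType K) : lmodType K :=
  tens (fun (m : M) (c : K) => c *: m) (fun (c : K) (n : N) => c *: n).
Notation "M ⊗ N" := (tensK M N) (at level 40, left associativity) : type_scope.

(* Sweedler-style summation: F summed over a decomposition of t as a sum of
   pure tensors a (x) b. *)
Notation "'\sweedler_' ( a , b <- t ) F" := (tlift (fun a b => F) t)
  (at level 41, F at level 41, a name, b name, t at level 200,
   format "'\sweedler_' ( a ,  b  <-  t )  F") : ring_scope.

Lemma tlift_comp (K : fieldType) (M N : lmodType K) (T : Type)
    (ra : M -> T -> M) (la : T -> N -> N) (V : lmodType K) (W : nmodType)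
    (L : {additive V -> W}) (f : M -> N -> V) (t : tens ra la) :
  L (tlift f t) = \sum_(p <- repr t) L (f p.1 p.2).
Proof. by rewrite /tlift /sum_over raddf_sum. Qed.

Section HopfAlgebra.
Variable K : fieldType.

Definition tmapr (A M N : lmodType K) (f : M -> N) (t : A ⊗ M) : A ⊗ N :=
  \sweedler_(a, m <- t) (a ⊙ f m : A ⊗ N).

(* (a (x) m, b (x) n) |-> ab (x) (act m n) *)
Definition tact (A : algType K) (M N V : lmodType K) (act : M -> N -> V)
    (s : A ⊗ M) (t : A ⊗ N) : A ⊗ V :=
  \sweedler_(a, m <- s) \sweedler_(b, n <- t) ((a * b) ⊙ act m n : A ⊗ V).

Definition coaction_axioms (A : algType K) (comul : A -> A ⊗ A)
    (counit : A -> K) (M : lmodType K) (coact : M -> A ⊗ M) : Prop :=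
  [/\ linear coact,
      forall m,
        \sweedler_(a, m0 <- coact m)
          \sweedler_(a1, a2 <- comul a) (a1 ⊙ (a2 ⊙ m0) : A ⊗ (A ⊗ M))
        = \sweedler_(a, m0 <- coact m) (a ⊙ coact m0)
    & forall m, \sweedler_(a, m0 <- coact m) (counit a *: m0) = m].

Record hopfAlg := HopfAlg {
  hopf_alg :> algType K;
  comul : hopf_alg -> hopf_alg ⊗ hopf_alg;
  counit : hopf_alg -> K;
  antip : hopf_alg -> hopf_alg;
  counit_linear : scalar counit;
  antip_linear : linear antip;
  comul_coaction : coaction_axioms comul counit comul;
  comul_counitr :
    forall a, \sweedler_(a1, a2 <- comul a) (counit a2 *: a1) = a;
  comulM : forall a b, comul (a * b) = tact *%R (comul a) (comul b);
  comul1 : comul 1 = 1 ⊙ 1;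
  counitM : forall a b, counit (a * b) = counit a * counit b;
  counit1 : counit 1 = 1;
  antipl : forall a, \sweedler_(a1, a2 <- comul a) (antip a1 * a2) = (counit a)%:A;
  antipr : forall a, \sweedler_(a1, a2 <- comul a) (a1 * antip a2) = (counit a)%:A
}.

Definition is_coaction (A : hopfAlg) (M : lmodType K) (coact : M -> A ⊗ M) :=
  coaction_axioms (@comul A) (@counit A) coact.

Definition is_subspace (V : lmodType K) (P : V -> Prop) : Prop :=
  P 0 /\ forall (c : K) x y, P x -> P y -> P (c *: x + y).

Definition is_subalg (A : algType K) (P : A -> Prop) : Prop :=
  [/\ is_subspace P, P 1 & forall x y, P x -> P y -> P (x * y)].

Definition generated_subalg (A : algType K) (G : A -> Prop) (x : A) : Prop :=
  forall P : A -> Prop, is_subalg P -> (forall y, G y -> P y) -> P x.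

Definition is_hopf_subalg (A : hopfAlg) (P : A -> Prop) : Prop :=
  [/\ is_subalg P, forall a, P a -> P (antip a)
    & forall a, P a -> exists2 s : seq (A * A),
        (forall p, p \in s -> P p.1 /\ P p.2)
        & comul a = \sum_(p <- s) p.1 ⊙ p.2].

End HopfAlgebra.

Section Bimodules.
Variable K : fieldType.

Record bimod (B : algType K) := Bimod {
  bimod_car :> lmodType K;
  bl : B -> bimod_car -> bimod_car;
  br : bimod_car -> B -> bimod_car;
  bl_linl : forall m, linear (bl^~ m);
  bl_linr : forall b, linear (bl b);
  blM : forall b c m, bl (b * c) m = bl b (bl c m);
  bl1 : forall m, bl 1 m = m;
  br_linl : forall b, linear (br^~ b);
  br_linr : forall m, linear (br m);
  brM : forall m b c, br m (b * c) = br (br m b) c;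
  br1 : forall m, br m 1 = m;
  blr : forall b m c, bl b (br m c) = br (bl b m) c
}.

Section TensorOver.
Variables (B : algType K) (M N : bimod B).

Let T : lmodType K := tens (@br B M) (@bl B N).
Let T_bl (b : B) (t : T) : T := \sweedler_(m, n <- t) (bl b m ⊙ n : T).
Let T_br (t : T) (b : B) : T := \sweedler_(m, n <- t) (m ⊙ br n b : T).

Let bal : balanced (@br B M) (@bl B N)
  (tpure : M -> N -> T) := tpure_balanced _ _.

Let T_bl_bal b : balanced (@br B M) (@bl B N) (fun m n => bl b m ⊙ n : T).
Proof.
case: bal => hl hr hm; split=> [n c m m'|m|m c n]; rewrite ?bl_linr ?hl //.
by rewrite blr hm.
Qed.

Let T_br_bal b : balanced (@br B M) (@bl B N) (fun m n => m ⊙ br n b : T).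
Proof.
case: bal => hl hr hm; split=> [n|m c n n'|m c n]; rewrite ?br_linl ?hr //.
by rewrite hm blr.
Qed.

Let T_blE b m n : T_bl b (m ⊙ n) = bl b m ⊙ n.
Proof. exact: (tlift_pure _ _ (T_bl_bal b)). Qed.
Let T_brE m n b : T_br (m ⊙ n) b = m ⊙ br n b.
Proof. exact: (tlift_pure _ _ (T_br_bal b)). Qed.

Let T_bl_linr b : linear (T_bl b). Proof. exact: tlift_linear. Qed.
Let T_br_linl b : linear (T_br^~ b). Proof. exact: tlift_linear. Qed.

Let lin0 (V W : lmodType K) (f : V -> W) : linear f -> f 0 = 0.
Proof. by move=> h; have := h (-1) 0 0; rewrite scaler0 addr0 scaleN1r addNr. Qed.
Let linD (V W : lmodType K) (f : V -> W) u v : linear f -> f (u + v) = f u + f v.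
Proof. by move=> h; have := h 1 u v; rewrite !scale1r. Qed.

Let T_bl_linl t : linear (T_bl^~ t).
Proof.
elim/tens_ind: t => [|m n t IH] c b b'.
  by rewrite !(lin0 (T_bl_linr _)) scaler0 addr0.
rewrite !(linD _ _ (T_bl_linr _)) IH !T_blE bl_linl; case: bal => -> _ _.
by rewrite scalerDr !addrA; congr (_ + _); rewrite -!addrA; congr (_ + _); exact: addrC.
Qed.

Let T_br_linr t : linear (T_br t).
Proof.
elim/tens_ind: t => [|m n t IH] c b b'.
  by rewrite !(lin0 (T_br_linl _)) scaler0 addr0.
rewrite !(linD _ _ (T_br_linl _)) IH !T_brE br_linr; case: bal => _ -> _.
by rewrite scalerDr !addrA; congr (_ + _); rewrite -!addrA; congr (_ + _); exact: addrC.
Qed.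

Let T_blM b c t : T_bl (b * c) t = T_bl b (T_bl c t).
Proof.
elim/tens_ind: t => [|m n t IH]; first by rewrite !(lin0 (T_bl_linr _)).
by rewrite !(linD _ _ (T_bl_linr _)) IH !T_blE blM.
Qed.

Let T_bl1 t : T_bl 1 t = t.
Proof.
elim/tens_ind: t => [|m n t IH]; first by rewrite !(lin0 (T_bl_linr _)).
by rewrite !(linD _ _ (T_bl_linr _)) IH !T_blE bl1.
Qed.

Let T_brM t b c : T_br t (b * c) = T_br (T_br t b) c.
Proof.
elim/tens_ind: t => [|m n t IH]; first by rewrite !(lin0 (T_br_linl _)).
by rewrite !(linD _ _ (T_br_linl _)) IH !T_brE brM.
Qed.

Let T_br1 t : T_br t 1 = t.
Proof.
elim/tens_ind: t => [|m n t IH]; first by rewrite !(lin0 (T_br_linl _)).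
by rewrite !(linD _ _ (T_br_linl _)) IH !T_brE br1.
Qed.

Let T_blr b t c : T_bl b (T_br t c) = T_br (T_bl b t) c.
Proof.
elim/tens_ind: t => [|m n t IH].
  by rewrite !(lin0 (T_br_linl _), lin0 (T_bl_linr _)).
by rewrite !(linD _ _ (T_br_linl _), linD _ _ (T_bl_linr _)) IH !(T_blE, T_brE).
Qed.

Definition tensB : bimod B :=
  Bimod T_bl_linl T_bl_linr T_blM T_bl1 T_br_linl T_br_linr T_brM T_br1 T_blr.

End TensorOver.

Definition is_bimod_map (B : algType K) (M N : bimod B) (f : M -> N) : Prop :=
  [/\ linear f, forall b m, f (bl b m) = bl b (f m)
    & forall m b, f (br m b) = br (f m) b].

Definition is_fodc (B : algType K) (Om : bimod B) (d : B -> Om) : Prop :=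
  [/\ linear d, forall b c, d (b * c) = br (d b) c + bl b (d c)
    & forall w, exists s : seq (B * B), w = \sum_(p <- s) bl p.1 (d p.2)].

Definition is_connection (B : algType K) (Om : bimod B) (d : B -> Om)
    (F : bimod B) (nabla : F -> tensB Om F) : Prop :=
  linear nabla /\
  forall b f, nabla (bl b f) = (d b ⊙ f : tensB Om F) + bl b (nabla f).

Definition is_associated_bimod_map (B : algType K) (Om : bimod B)
    (d : B -> Om) (F : bimod B) (nabla : F -> tensB Om F)
    (sigma : tensB F Om -> tensB Om F) : Prop :=
  is_bimod_map sigma /\
  forall f b, sigma (f ⊙ d b) = nabla (br f b) - br (nabla f) b.

End Bimodules.

Section Lie.
Variable K : fieldType.

Record simpleLie := SimpleLie {
  lie_car :> vectType K;
  bracket : lie_car -> lie_car -> lie_car;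
  bracket_linl : forall y, linear (bracket^~ y);
  bracket_linr : forall x, linear (bracket x);
  bracketxx : forall x, bracket x x = 0;
  jacobi : forall x y z, bracket x (bracket y z) + bracket y (bracket z x)
                         + bracket z (bracket x y) = 0;
  lie_nonabelian : exists x y, bracket x y != 0;
  lie_simple : forall I : {vspace lie_car},
    (forall x y, y \in I -> bracket x y \in I) -> I = 0%VS \/ I = fullv
}.

Definition root_vector (g : simpleLie) (h : {vspace g})
    (lam : 'Hom(subvs_of h, K^o)) (y : g) : Prop :=
  forall t : subvs_of h, bracket (vsval t) y = (lam t : K) *: y.

Definition is_root (g : simpleLie) (h : {vspace g})
    (lam : 'Hom(subvs_of h, K^o)) : Prop :=
  lam != 0 /\ exists2 y : g, y != 0 & root_vector lam y.

(* A Cartan subalgebra (given as a maximal toral subalgebra), simple roots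
   alpha_i, the Cartan matrix a_ij = alpha_j(h_i), where h_i is the coroot of
   alpha_i, and the halves d_i = (alpha_i, alpha_i) / 2 of the squared
   lengths, for the form with (alpha_i, alpha_j) = d_i a_ij in which short
   simple roots have squared length 2. *)
Record rootDatum (g : simpleLie) := RootDatum {
  csa : {vspace g};
  csa_abelian : forall s t, s \in csa -> t \in csa -> bracket s t = 0;
  csa_diagonalizable : forall t, t \in csa -> forall y, exists2 s : seq g,
    (forall u, u \in s -> exists c : K, bracket t u = c *: u)
    & y = \sum_(u <- s) u;
  csa_maximal : forall y, (forall t, t \in csa -> bracket t y = 0) -> y \in csa;
  rk : nat;
  sroot : 'I_rk -> 'Hom(subvs_of csa, K^o);
  sroot_root : forall i, is_root (sroot i);
  sroot_free : forall c : 'I_rk -> K,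
    \sum_i c i *: sroot i = 0 -> forall i, c i = 0;
  sroot_base : forall lam, is_root lam -> exists2 n : 'I_rk -> int,
    (forall i, 0 <= n i) \/ (forall i, n i <= 0)
    & lam = \sum_i (n i)%:~R *: sroot i;
  cartan : 'I_rk -> 'I_rk -> int;
  cartanP : forall i, exists (e f : g) (t : subvs_of csa),
    [/\ root_vector (sroot i) e, root_vector (- sroot i) f,
        vsval t = bracket e f, sroot i t = 2
      & forall j, sroot j t = (cartan i j)%:~R];
  halfsq : 'I_rk -> nat;
  halfsq_gt0 : forall i, (0 < halfsq i)%N;
  halfsq_sym : forall i j,
    (halfsq i)%:Z * cartan i j = (halfsq j)%:Z * cartan j i;
  halfsq_short : exists i, halfsq i = 1%N
}.

Definition highest_root (g : simpleLie) (D : rootDatum g)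
    (n : 'I_(rk D) -> int) : Prop :=
  is_root (\sum_i (n i)%:~R *: sroot i) /\
  forall m : 'I_(rk D) -> int,
    is_root (\sum_i (m i)%:~R *: sroot i) -> forall i, m i <= n i.

Definition cominuscule (g : simpleLie) (D : rootDatum g) (x : 'I_(rk D)) : Prop :=
  exists2 n, highest_root n & n x = 1.

End Lie.

Section QuantumGroup.
Variables (R : realType) (q : R) (g : simpleLie R[i]) (D : rootDatum g).
Local Notation C := R[i].
Local Notation I := 'I_(rk D).

Definition qi (i : I) : C := ((q ^+ halfsq i)%:C)%C.

Definition qnum (p : C) (n : nat) : C := (p ^+ n - p ^- n) / (p - p^-1).
Definition qfact (p : C) (n : nat) : C := \prod_(1 <= m < n.+1) qnum p m.
Definition qbinom (p : C) (n m : nat) : C :=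
  qfact p n / (qfact p m * qfact p (n - m)).

Definition q_serre (A : algType C) (X : I -> A) : Prop :=
  forall i j, i != j ->
    let n := `|1 - cartan i j|%N in
    \sum_(r < n.+1)
      ((-1) ^+ r * qbinom (qi i) n r) *: (X i ^+ (n - r) * X j * X i ^+ r) = 0.

(* Kp i and Km i stand for K_i and K_i^-1 *)
Definition Uq_relations (A : algType C) (E F Kp Km : I -> A) : Prop :=
  [/\ forall i, Kp i * Km i = 1 /\ Km i * Kp i = 1,
      forall i j, Kp i * Kp j = Kp j * Kp i,
      forall i j, Kp i * E j = qi i ^ cartan i j *: (E j * Kp i)
               /\ Kp i * F j = qi i ^ (- cartan i j) *: (F j * Kp i),
      forall i j, E i * F j - F j * E i =
        if i == j then (qi i - (qi i)^-1)^-1 *: (Kp i - Km i) else 0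
    & q_serre E /\ q_serre F].

(* The Hopf algebra U_q(g), characterised up to unique isomorphism as the
   algebra presented by Uq_relations, with the given coproduct and counit. *)
Record quantumGroup := QuantumGroup {
  uq :> hopfAlg C;
  uE : I -> uq;
  uF : I -> uq;
  uK : I -> uq;
  uKV : I -> uq;
  uq_rel : Uq_relations uE uF uK uKV;
  uq_univ : forall (A : algType C) (E F Kp Km : I -> A),
    Uq_relations E F Kp Km ->
    let maps (phi : uq -> A) := forall i,
      [/\ phi (uE i) = E i, phi (uF i) = F i,
          phi (uK i) = Kp i & phi (uKV i) = Km i] in
    exists2 phi : {lrmorphism uq -> A}, maps phi
      & forall psi : {lrmorphism uq -> A}, maps psi -> psi =1 phi;
  comul_K : forall i, comul (uK i) = uK i ⊙ uK i;
  comul_E : forall i, comul (uE i) = uE i ⊙ uK i + 1 ⊙ uE i;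
  comul_F : forall i, comul (uF i) = uF i ⊙ 1 + uKV i ⊙ uF i;
  counit_E : forall i, counit (uE i) = 0;
  counit_F : forall i, counit (uF i) = 0;
  counit_K : forall i, counit (uK i) = 1
}.

Variable U : quantumGroup.

Record uqModule := UqModule {
  uqm_car :> vectType C;
  act : U -> uqm_car -> uqm_car;
  act_linl : forall v, linear (act^~ v);
  act_linr : forall X, linear (act X);
  actM : forall X Y v, act (X * Y) v = act X (act Y v);
  act1 : forall v, act 1 v = v
}.

(* (mu i) are the coordinates of the weight in the basis of fundamental
   weights, so that q^(weight, alpha_i) = q_i^(mu i) *)
Definition has_weight (V : uqModule) (mu : I -> int) (v : V) : Prop :=
  forall i, act (uK U i) v = qi i ^ mu i *: v.

Definition type1 (V : uqModule) : Prop :=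
  forall v : V, exists2 s : seq V,
    (forall u, u \in s -> exists mu, has_weight mu u) & v = \sum_(u <- s) u.

Definition irreducible_module (V : uqModule) : Prop :=
  (fullv : {vspace V}) <> 0%VS /\
  forall W : {vspace V}, (forall X v, v \in W -> act X v \in W) ->
    W = 0%VS \/ W = fullv.

(* The coordinate function c^V_{f,v} *)
Definition coordfun (V : uqModule) (f : {scalar V}) (v : V) (X : U) : C :=
  f (act X v).

(* O_q(G): the Hopf algebra structure is the one of the dual of U, and ev
   embeds it in the dual as the Hopf subalgebra generated by the coordinate
   functions of type-1 modules. *)
Record coordAlg := CoordAlg {
  oq :> hopfAlg C;
  ev : oq -> U -> C;
  ev_linl : forall X, scalar (ev^~ X);
  ev_linr : forall a, scalar (ev a);
  ev_inj : forall a b, ev a =1 ev b -> a = b;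
  evM : forall a b X,
    ev (a * b) X = \sweedler_(X1, X2 <- comul X) (ev a X1 * ev b X2 : C^o);
  ev1 : forall X, ev 1 X = counit X;
  ev_comul : forall a X Y,
    \sweedler_(a1, a2 <- comul a) (ev a1 X * ev a2 Y : C^o) = ev a (X * Y);
  ev_counit : forall a, counit a = ev a 1;
  ev_antip : forall a X, ev (antip a) X = ev a (antip X);
  ev_coordfun : forall V : uqModule, type1 V -> forall (f : {scalar V}) (v : V),
    exists a, ev a =1 coordfun f v;
  ev_generated : forall P : oq -> Prop, is_hopf_subalg P ->
    (forall V : uqModule, type1 V -> forall (f : {scalar V}) (v : V) a,
       ev a =1 coordfun f v -> P a) ->
    forall a, P a
}.

Variable A : coordAlg.

(* X |> a = a_(1) <a_(2), X>, see ev_lact *)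
Definition lact (X : U) (a : A) : A :=
  \sweedler_(a1, a2 <- comul a) (ev a2 X *: a1).

Lemma ev_lact (X Y : U) (a : A) : ev (lact X a) Y = ev a (Y * X).
Proof.
rewrite -ev_comul /lact /tlift /sum_over.
elim: (repr _) => [|p s IH].
  rewrite !big_nil; have := ev_linl Y (-1) (0 : A) 0.
  by rewrite /= scaler0 addr0 mulN1r addNr.
by rewrite !big_cons (ev_linl Y (ev p.2 X)) IH mulrC.
Qed.

Lemma lact_coordfun (V : uqModule) (f : {scalar V}) (v : V) (X : U) (a : A) :
  ev a =1 coordfun f v -> ev (lact X a) =1 coordfun f (act X v).
Proof. by move=> h Y; rewrite ev_lact h /coordfun actM. Qed.

Definition levi_gen (x : I) (X : U) : Prop :=
  (exists i, X = uK U i \/ X = uKV U i) \/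
  exists2 s, s != x & X = uE U s \/ X = uF U s.

Definition levi_ss_gen (x : I) (X : U) : Prop :=
  exists2 s, s != x & [\/ X = uK U s, X = uKV U s, X = uE U s | X = uF U s].

Definition levi x := generated_subalg (levi_gen x).
Definition levi_ss x := generated_subalg (levi_ss_gen x).

Definition invariants (L : U -> Prop) (a : A) : Prop :=
  forall X, L X -> lact X a = counit X *: a.

(* The irreducible type-1 module V_{varpi_x} with a weight basis whose last
   vector is a highest weight vector *)
Record fundModule (x : I) := FundModule {
  fm :> uqModule;
  fm_type1 : type1 fm;
  fm_irr : irreducible_module fm;
  fm_dim : nat;
  fm_basis : fm_dim.+1.-tuple fm;
  fm_basisP : basis_of fullv fm_basis;
  fm_weight : forall i : 'I_fm_dim.+1, exists mu, has_weight mu fm_basis`_i;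
  fm_high_E : forall i, act (uE U i) fm_basis`_fm_dim = 0;
  fm_high_K : has_weight (fun i => (i == x)%:Z) fm_basis`_fm_dim
}.

Variables (x : I) (V : fundModule x).
Local Notation N := (fm_dim V).+1.
Local Notation v := (fm_basis V).
Local Notation f := (coord (fm_basis V)).

(* z_i = c_{f_i, v_N} *)
Definition is_z (i : 'I_N) (a : A) : Prop :=
  forall X, ev a X = f i (act X v`_(fm_dim V)).

(* zbar_j = c_{v_j, f_N} for the dual module: zbar_j(X) = (X f_N)(v_j)
   = f_N(S(X) v_j) *)
Definition is_zbar (j : 'I_N) (a : A) : Prop :=
  forall X, ev a X = f ord_max (act (antip X) v`_j).

(* The subspace E_k spanned by the monomials in the z_i and zbar_j whose
   total degree is k, where deg z_i = 1 and deg zbar_j = -1 *)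
Inductive line : int -> A -> Prop :=
| line_one : line 0 1
| line_z k i z a : is_z i z -> line k a -> line (k + 1) (z * a)
| line_zbar k j z a : is_zbar j z -> line k a -> line (k - 1) (z * a)
| line_lin k (c : C) a b : line k a -> line k b -> line k (c *: a + b).

End QuantumGroup.
Arguments is_z {R q g D U A x} V i a.
Arguments is_zbar {R q g D U A x} V j a.

Section Covariance.
Variables (K : fieldType) (A : hopfAlg K).

(* A left A-comodule algebra embedded in A, with coaction induced by comul *)
Record subComodAlg := SubComodAlg {
  sca :> algType K;
  incl : {lrmorphism sca -> A};
  incl_inj : injective incl;
  coactL : sca -> A ⊗ sca;
  coactLP : is_coaction coactL;
  coactLM : forall b c, coactL (b * c) = tact *%R (coactL b) (coactL c);
  coactL1 : coactL 1 = 1 ⊙ 1;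
  incl_coact : forall b, tmapr incl (coactL b) = comul (incl b)
}.
Arguments incl {s}.

Section Over.
Variable B : subComodAlg.

Definition augm (b : B) : K := counit (incl b).

(* m \in B^+ M, resp. m \in M B^+ *)
Definition in_BplusM (M : bimod B) (m : M) : Prop :=
  exists2 s : seq (B * M), (forall p, p \in s -> augm p.1 = 0)
    & m = \sum_(p <- s) bl p.1 p.2.

Definition in_MBplus (M : bimod B) (m : M) : Prop :=
  exists2 s : seq (M * B), (forall p, p \in s -> augm p.2 = 0)
    & m = \sum_(p <- s) br p.1 p.2.

(* Left A-comodules with a compatible B-bimodule structure such that
   M B^+ = B^+ M *)
Record relHopf := RelHopf {
  rh_bimod :> bimod B;
  coact : rh_bimod -> A ⊗ rh_bimod;
  coactP : is_coaction coact;
  coact_bl : forall b m,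
    coact (bl b m) = tact (@bl _ _ rh_bimod) (coactL b) (coact m);
  coact_br : forall m b,
    coact (br m b) = tact (@br _ _ rh_bimod) (coact m) (coactL b);
  Bplus_comm : forall m : rh_bimod, in_MBplus m <-> in_BplusM m
}.

Definition tens_coact (M N : relHopf) (t : tensB M N) : A ⊗ tensB M N :=
  \sweedler_(m, n <- t)
    tact (fun m n => m ⊙ n : tensB M N) (coact m) (coact n).

Definition covariant_fodc (Om : bimod B) (d : B -> Om)
    (delta : Om -> A ⊗ Om) : Prop :=
  is_coaction delta /\
  forall b c, delta (bl b (d c)) =
    tact (fun b c => bl b (d c)) (coactL b) (coactL c).

Definition covariant_connection (Om : relHopf) (d : B -> Om) (F : relHopf)
    (nabla : F -> tensB Om F) : Prop :=
  is_connection d nabla /\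
  forall f, tens_coact (nabla f) = tmapr nabla (coact f).

(* Phi(M) = M / B^+ M *)
Section Phi.
Variable M : bimod B.

Lemma BplusM0 : @in_BplusM M 0.
Proof. by exists [::] => //; rewrite big_nil. Qed.

Lemma BplusMD (m n : M) : in_BplusM m -> in_BplusM n -> in_BplusM (m + n).
Proof.
move=> [s hs ->] [s' hs' ->]; exists (s ++ s'); last by rewrite big_cat.
by move=> p; rewrite mem_cat => /orP[/hs|/hs'].
Qed.

Lemma BplusMZ (c : K) (m : M) : in_BplusM m -> in_BplusM (c *: m).
Proof.
move=> [s hs ->]; exists [seq (p.1, c *: p.2) | p <- s].
  by move=> _ /mapP[p ps ->] /=; move: (hs p ps).
rewrite big_map scaler_sumr; apply: eq_bigr => p _ /=.
have h0 : bl p.1 (0 : M) = 0.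
  by have := bl_linr p.1 (-1) (0 : M) 0; rewrite scaler0 addr0 scaleN1r addNr.
by have := bl_linr p.1 c p.2 0; rewrite !addr0 h0 addr0.
Qed.

Definition Phi_rel (m n : M) : bool := `[< in_BplusM (m - n) >].

Lemma Phi_rel_refl : reflexive Phi_rel.
Proof. by move=> m; apply/asboolP; rewrite subrr; exact: BplusM0. Qed.
Lemma Phi_rel_sym : symmetric Phi_rel.
Proof.
by move=> m n; apply/asboolP/asboolP => /(BplusMZ (-1));
  rewrite scaleN1r opprB.
Qed.
Lemma Phi_rel_trans : transitive Phi_rel.
Proof.
move=> n m p /asboolP h /asboolP h'; apply/asboolP.
by rewrite -[m](subrK n) -addrA; exact: BplusMD.
Qed.

Canonical Phi_equiv := EquivRel Phi_rel Phi_rel_refl Phi_rel_sym Phi_rel_trans.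

Definition Phi : Type := {eq_quot Phi_equiv}.
HB.instance Definition _ := Choice.on Phi.
HB.instance Definition _ := Quotient.on Phi.
HB.instance Definition _ := EqQuotient.on Phi.

Definition cls (m : M) : Phi := \pi_Phi m.

Lemma cls_eqP (m n : M) : cls m = cls n <-> in_BplusM (m - n).
Proof. by split=> [/eqmodP/asboolP|h]; last exact/eqmodP/asboolP. Qed.

Lemma Phi_repr (m : M) : in_BplusM (repr (cls m) - m).
Proof. by apply/cls_eqP; rewrite /cls reprK. Qed.

Definition Phi_add (x y : Phi) : Phi := cls (repr x + repr y).
Definition Phi_scale (c : K) (x : Phi) : Phi := cls (c *: repr x).

Lemma cls_add m n : Phi_add (cls m) (cls n) = cls (m + n).
Proof. by apply/cls_eqP; rewrite opprD addrACA; apply: BplusMD; exact: Phi_repr. Qed.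
Lemma cls_scale c m : Phi_scale c (cls m) = cls (c *: m).
Proof. by apply/cls_eqP; rewrite -scalerBr; apply: BplusMZ; exact: Phi_repr. Qed.
Lemma cls_repr (x : Phi) : cls (repr x) = x.
Proof. exact: reprK. Qed.

Lemma Phi_addA : associative Phi_add.
Proof.
by move=> x y z; rewrite -[x]cls_repr -[y]cls_repr -[z]cls_repr !cls_add addrA.
Qed.
Lemma Phi_addC : commutative Phi_add.
Proof. by move=> x y; rewrite /Phi_add addrC. Qed.
Lemma Phi_add0 : left_id (cls 0) Phi_add.
Proof. by move=> x; rewrite -[x]cls_repr cls_add add0r. Qed.
Lemma Phi_addN : left_inverse (cls 0) (Phi_scale (-1)) Phi_add.
Proof.
by move=> x; rewrite -[x]cls_repr cls_scale cls_add scaleN1r addNr.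
Qed.
HB.instance Definition _ :=
  GRing.isZmodule.Build Phi Phi_addA Phi_addC Phi_add0 Phi_addN.

Lemma Phi_scaleA a b x : Phi_scale a (Phi_scale b x) = Phi_scale (a * b) x.
Proof. by rewrite -[x]cls_repr !cls_scale scalerA. Qed.
Lemma Phi_scale1 : left_id 1 Phi_scale.
Proof. by move=> x; rewrite -[x]cls_repr cls_scale scale1r. Qed.
Lemma Phi_scaleDr : right_distributive Phi_scale +%R.
Proof.
move=> a x y; rewrite -[x]cls_repr -[y]cls_repr.
by rewrite [cls _ + cls _]cls_add !cls_scale scalerDr [RHS]cls_add.
Qed.
Lemma Phi_scaleDl x : {morph Phi_scale^~ x : a b / a + b}.
Proof.
by move=> a b; rewrite -[x]cls_repr !cls_scale scalerDl [RHS]cls_add.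
Qed.
HB.instance Definition _ := GRing.Zmodule_isLmodule.Build K Phi
  Phi_scaleA Phi_scale1 Phi_scaleDr Phi_scaleDl.

End Phi.

(* The map induced by f on the quotients, for f a bimodule map *)
Definition Phi_map (M N : bimod B) (f : M -> N) (x : Phi M) : Phi N :=
  cls (f (repr x)).

(* The identification [m] (x) [n] |-> [m (x) n] *)
Definition Phi_tens (M N : bimod B) :
    (Phi M : lmodType K) ⊗ (Phi N : lmodType K) -> Phi (tensB M N) :=
  tlift (fun (x : Phi M) (y : Phi N) => cls (repr x ⊙ repr y : tensB M N)).

Definition fin_dim_calculus (Om : bimod B) : Prop :=
  exists s : seq (Phi Om), forall x : Phi Om,
    exists c : 'I_(size s) -> K, x = \sum_i c i *: s`_i.

Definition irreducible_calculus (Om : relHopf) : Prop :=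
  (exists w : Om, w != 0) /\
  forall W : Om -> Prop, is_subspace W ->
    (forall b w, W w -> W (bl b w) /\ W (br w b)) ->
    (forall w, W w -> exists2 s : seq (A * Om),
       (forall p, p \in s -> W p.2) & coact w = \sum_(p <- s) p.1 ⊙ p.2) ->
    (forall w, W w -> w = 0) \/ (forall w, W w).

End Over.

Definition is_grading (V : lmodType K) (G : int -> V -> Prop) : Prop :=
  [/\ forall k, is_subspace (G k),
      forall v, exists (s : seq int) (w : int -> V),
        (forall k, G k (w k)) /\ v = \sum_(k <- s) w k
    & forall (s : seq int) (w : int -> V), uniq s -> (forall k, G k (w k)) ->
        \sum_(k <- s) w k = 0 -> forall k, k \in s -> w k = 0].

(* Om is isomorphic to the sub-calculus over B generated by the dP b, b in B *)
Definition is_restriction (P B : subComodAlg) (Ga : bimod P) (dP : P -> Ga)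
    (Om : bimod B) (d : B -> Om) : Prop :=
  exists r : Om -> Ga,
    [/\ linear r, injective r
      & forall (b : B) (p : P), incl p = incl b ->
          [/\ r (d b) = dP p, forall w, r (bl b w) = bl p (r w)
            & forall w, r (br w b) = br (r w) p]].

End Covariance.
Arguments incl {K A s}.

Section HeckenbergerKolb.
Variables (R : realType) (q : R) (g : simpleLie R[i]) (D : rootDatum g).
Variables (U : quantumGroup q D) (A : coordAlg U) (x : 'I_(rk D)).
Variable V : fundModule U x.

Definition is_flag_manifold (B : subComodAlg A) : Prop :=
  forall a : A, (exists b : B, incl b = a) <-> invariants (levi x) a.

Definition is_Poisson_space (P : subComodAlg A) : Prop :=
  forall a : A, (exists p : P, incl p = a) <-> invariants (levi_ss x) a.

(* A right O(U_1)-coaction is a Z-grading; the coaction on P is the grading by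
   the spaces E_k. *)
Definition U1_covariant (P : subComodAlg A) (Ga : bimod P) (d : P -> Ga) : Prop :=
  exists2 G : int -> Ga -> Prop, is_grading G
    & forall j k p p', line V j (incl p) -> line V k (incl p') ->
        G (j + k) (bl p (d p')).

Definition is_HK01 (P B : subComodAlg A) (Om : relHopf B) (d : B -> Om) : Prop :=
  [/\ is_fodc d, covariant_fodc d (@coact _ _ _ Om), irreducible_calculus Om,
      fin_dim_calculus Om
    & exists (Ga : bimod P) (dP : P -> Ga) (delta : Ga -> A ⊗ Ga),
        [/\ is_fodc dP, covariant_fodc dP delta, U1_covariant dP,
            forall i p, is_z V i (incl p) -> dP p = 0
          & is_restriction dP d]].

(* iota identifies E with the sub-bimodule and subcomodule E_k of A *)
Definition is_relative_line (B : subComodAlg A) (k : int) (E : relHopf B)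
    (iota : E -> A) : Prop :=
  [/\ linear iota /\ injective iota,
      forall b e, iota (bl b e) = incl b * iota e,
      forall e b, iota (br e b) = iota e * incl b,
      forall e, tmapr iota (coact e) = comul (iota e)
    & forall a, (exists e, iota e = a) <-> line V k a].

End HeckenbergerKolb.

(* m |-> m_(-2) (x) (m_(-1) (x) m_(0)) *)
Definition coact2 (K : fieldType) (A : hopfAlg K) (M : lmodType K)
    (delta : M -> A ⊗ M) (m : M) : A ⊗ (A ⊗ M) := tmapr delta (delta m).

(* A as a right B-module *)
Definition rmulB (K : fieldType) (A : hopfAlg K) (B : subComodAlg A)
    (a : A) (b : B) : A := a * incl b.
Definition tensAB (K : fieldType) (A : hopfAlg K) (B : subComodAlg A)
    (M : bimod B) : lmodType K := tens (@rmulB K A B) (@bl _ B M).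

(* Main.v *)
(* For any left A-comodule M with compatible left B-action, the map
   untwist a m = a S(m_(-1)) (x)_B m_(0) from A (x) M to A (x)_B M satisfies
   untwist m_(-1) m_(0) = 1 (x) m, and it depends on m only through its class
   in Phi(M), since S(b_(1)) b_(2) = 0 for b in B^+.  Covariance of the
   connection makes sigma colinear on the elements e (x) d b, so
   1 (x) sigma(e (x) d b) is the sum of untwist applied to e_(-1) b_(1) and
   sigma(e_(0) (x) d b_(2)).  Modulo B^+ one may replace the latter by
   theta^k (d b_(2) (x) e_(0)), and expanding untwist gives the formula. *)
Require Import Defs.
From mathcomp Require Import all_boot all_order all_algebra.
From mathcomp Require Import complex reals.
Import GRing.Theory.
Local Open Scope ring_scope.

(** * Linear maps and Sweedler sums *)

Section Linearity.
Set Implicit Arguments.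
Unset Strict Implicit.
Variable K : fieldType.
Implicit Types (V W : lmodType K).

Lemma linear_fun0 V W (f : V -> W) : linear f -> f 0 = 0.
Proof. by move=> h; have := h (-1) 0 0; rewrite scaler0 addr0 scaleN1r addNr. Qed.

Lemma linear_funD V W (f : V -> W) u v : linear f -> f (u + v) = f u + f v.
Proof. by move=> h; have := h 1 u v; rewrite !scale1r. Qed.

Lemma linear_funZ V W (f : V -> W) c u : linear f -> f (c *: u) = c *: f u.
Proof. by move=> h; have := h c u 0; rewrite (linear_fun0 h) !addr0. Qed.

Lemma linear_funB V W (f : V -> W) u v : linear f -> f (u - v) = f u - f v.
Proof. by move=> h; rewrite addrC -scaleN1r h scaleN1r addrC. Qed.

Lemma linear_fun_sum V W (f : V -> W) I (r : seq I) (F : I -> V) :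
  linear f -> f (\sum_(i <- r) F i) = \sum_(i <- r) f (F i).
Proof.
move=> h; elim: r => [|i r IH]; first by rewrite !big_nil (linear_fun0 h).
by rewrite !big_cons (linear_funD _ _ h) IH.
Qed.

Lemma linear_id V : linear (fun v : V => v).
Proof. by []. Qed.

Lemma linear_comp V1 V2 W (f : V2 -> W) (g : V1 -> V2) :
  linear f -> linear g -> linear (fun v => f (g v)).
Proof. by move=> hf hg c u v; rewrite hg hf. Qed.

Lemma linear_scale V W (d : K) (f : V -> W) :
  linear f -> linear (fun v => d *: f v).
Proof. by move=> hf c u v; rewrite hf scalerDr !scalerA mulrC. Qed.

Lemma linear_scaler V W (w : W) (f : V -> K^o) :
  linear f -> linear (fun v => (f v : K) *: w).
Proof. by move=> hf c u v; rewrite hf scalerDl scalerA. Qed.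

Lemma linear_mull V (A : algType K) (a : A) (f : V -> A) :
  linear f -> linear (fun v => a * f v).
Proof. by move=> hf c u v; rewrite hf mulrDr scalerAr. Qed.

Lemma linear_mulr V (A : algType K) (a : A) (f : V -> A) :
  linear f -> linear (fun v => f v * a).
Proof. by move=> hf c u v; rewrite hf mulrDl scalerAl. Qed.

Section Tlift.
Variables (M N : lmodType K) (T : Type) (ra : M -> T -> M) (la : T -> N -> N).
Implicit Types t : tens ra la.

Lemma linear_purel V (n : N) (f : V -> M) :
  linear f -> linear (fun v => f v ⊙ n : tens ra la).
Proof. by case: (tpure_balanced ra la) => h _ _ hf; apply: linear_comp (h n) hf. Qed.

Lemma linear_purer V (m : M) (f : V -> N) :
  linear f -> linear (fun v => m ⊙ f v : tens ra la).
Proof. by case: (tpure_balanced ra la) => _ h _ hf; apply: linear_comp (h m) hf. Qed.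

Lemma pure_balance m s n : ra m s ⊙ n = m ⊙ la s n :> tens ra la.
Proof. by case: (tpure_balanced ra la). Qed.

(** The tensor [t] is fixed, so all the sums run over one representative and linearity is checked
    term by term. *)
Lemma linear_tlift_fun V W (F : V -> M -> N -> W) t :
  (forall m n, linear (fun v => F v m n)) -> linear (fun v => tlift (F v) t).
Proof.
move=> h c u v; rewrite /tlift /sum_over scaler_sumr -big_split /=.
by apply: eq_bigr => p _; rewrite h.
Qed.

(** Here the tensor varies, and with it its representative; balancedness of [F] makes the sum
    independent of that choice. *)
Lemma linear_tlift V W (F : M -> N -> W) (f : V -> tens ra la) :
  balanced ra la F -> linear f -> linear (fun v => tlift F (f v)).
Proof. by move=> /tlift_linear hF hf; apply: linear_comp hF hf. Qed.

Lemma eq_tlift V (F G : M -> N -> V) t :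
  (forall m n, F m n = G m n) -> tlift F t = tlift G t.
Proof. by move=> h; apply: eq_bigr => p _; apply: h. Qed.

Lemma linear_fun_tlift V W (L : V -> W) (F : M -> N -> V) t :
  linear L -> L (tlift F t) = tlift (fun m n => L (F m n)) t.
Proof. by move=> hL; rewrite /tlift /sum_over linear_fun_sum. Qed.

Lemma exchange_tlift (M' N' : lmodType K) (T' : Type) (ra' : M' -> T' -> M')
    (la' : T' -> N' -> N') V (F : M -> N -> M' -> N' -> V) t
    (t' : tens ra' la') :
  tlift (fun m n => tlift (F m n) t') t
  = tlift (fun m' n' => tlift (fun m n => F m n m' n') t) t'.
Proof. exact: exchange_big. Qed.

Lemma eq_linear_tens V (f g : tens ra la -> V) : linear f -> linear g ->
  (forall m n, f (m ⊙ n) = g (m ⊙ n)) -> forall t, f t = g t.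
Proof.
move=> hf hg h; elim/tens_ind => [|m n t IH].
  by rewrite (linear_fun0 hf) (linear_fun0 hg).
by rewrite (linear_funD _ _ hf) (linear_funD _ _ hg) h IH.
Qed.

End Tlift.

Local Notation bilin f := (balanced (fun m c => c *: m) (fun c n => c *: n) f).

(** Balancing over the field itself is automatic: a scalar comes out of either argument by
    linearity. *)
Lemma bilinP (M N V : lmodType K) (f : M -> N -> V) :
  (forall n, linear (fun m => f m n)) -> (forall m, linear (fun n => f m n)) ->
  bilin f.
Proof.
move=> hl hr; split=> // m c n.
by rewrite (linear_funZ _ _ (hl n)) (linear_funZ _ _ (hr m)).
Qed.

Lemma linear_comul (A : hopfAlg K) V (f : V -> A) :
  linear f -> linear (fun v => comul (f v)).
Proof. by case: (comul_coaction A) => h _ _; apply: linear_comp. Qed.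

Lemma linear_counit (A : hopfAlg K) V (f : V -> A) :
  linear f -> linear (fun v => counit (f v) : K^o).
Proof. by move=> hf c u v; rewrite hf counit_linear. Qed.

Lemma linear_antip (A : hopfAlg K) V (f : V -> A) :
  linear f -> linear (fun v => antip (f v)).
Proof. by move=> hf c u v; rewrite hf antip_linear. Qed.

Lemma linear_bll (B : algType K) (M : bimod B) V (m : M) (f : V -> B) :
  linear f -> linear (fun v => bl (f v) m).
Proof. by move=> hf c u v; rewrite hf bl_linl. Qed.

Lemma linear_blr (B : algType K) (M : bimod B) V (b : B) (f : V -> M) :
  linear f -> linear (fun v => bl b (f v)).
Proof. by move=> hf c u v; rewrite hf bl_linr. Qed.

Lemma linear_brl (B : algType K) (M : bimod B) V (b : B) (f : V -> M) :
  linear f -> linear (fun v => br (f v) b).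
Proof. by move=> hf c u v; rewrite hf br_linl. Qed.

Lemma linear_coact (A : hopfAlg K) (B : subComodAlg A) (M : relHopf B) V
    (f : V -> M) : linear f -> linear (fun v => coact (f v)).
Proof. by case: (coactP M) => h _ _; apply: linear_comp. Qed.

End Linearity.

(* A pattern variable of Ltac may capture a bound variable, so the argument in
   which a bilinear operation depends on v is found by unification. *)
Ltac lin :=
  cbv beta;
  first [ match goal with
  | h : GRing.linear_for _ ?f |- GRing.linear_for _ ?f => exact: h
  | h : GRing.linear_for _ ?f |- GRing.linear_for _ (fun v => ?f _) =>
      apply: (linear_comp h); lin
  end | lin_rule ]
with lin_rule :=
  lazymatch goal with
  | |- balanced _ _ _ => apply: bilinP => ?; lin
  | |- GRing.linear_for _ (fun v => v) => exact: linear_id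
  | |- GRing.linear_for _ (fun v => tlift _ _) =>
      first [ apply: linear_tlift_fun => ? ?
            | apply: linear_tlift; [try lin | ] ]; lin
  | |- GRing.linear_for _ (fun v => tpure _ _) =>
      first [apply: linear_purel | apply: linear_purer]; lin
  | |- GRing.linear_for _ (fun v => _ * _) =>
      first [apply: linear_mulr | apply: linear_mull]; lin
  | |- GRing.linear_for _ (fun v => _ *: _) =>
      first [apply: linear_scale | apply: linear_scaler]; lin
  | |- GRing.linear_for _ (fun v => comul _) => apply: linear_comul; lin
  | |- GRing.linear_for _ (fun v => counit _) => apply: linear_counit; lin
  | |- GRing.linear_for _ (fun v => antip _) => apply: linear_antip; lin
  | |- GRing.linear_for _ (fun v => bl _ _) =>
      first [apply: linear_bll | apply: linear_blr]; lin
  | |- GRing.linear_for _ (fun v => br _ _) => apply: linear_brl; lin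
  | |- GRing.linear_for _ (fun v => coact _) => apply: linear_coact; lin
  | |- GRing.linear_for ?s ?f =>
      lazymatch f with fun _ => _ => fail | _ => idtac end;
      change (GRing.linear_for s (fun v => f v)); lin
  end.

(** * Coassociativity and the antipode *)

Section HopfModules.
Local Notation bilin f := (balanced (fun m c => c *: m) (fun c n => c *: n) f).
Set Implicit Arguments.
Unset Strict Implicit.
Variables (K : fieldType) (A : hopfAlg K).

Section Coaction.
Variables (M : lmodType K) (delta : M -> A ⊗ M).
Hypothesis deltaP : is_coaction delta.

(** A trilinear [F] induces a linear map on [A ⊗ (A ⊗ M)], which is applied to both sides of the
    coassociativity axiom. With [comul] as the coaction this is coassociativity of [A]. *)
Lemma coaction_assoc (V : lmodType K) (F : A -> A -> M -> V) m :
  (forall b n, linear (fun a => F a b n)) ->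
  (forall a n, linear (fun b => F a b n)) ->
  (forall a b, linear (fun n => F a b n)) ->
  \sweedler_(a, m0 <- delta m) \sweedler_(a1, a2 <- comul a) F a1 a2 m0
  = \sweedler_(a, m0 <- delta m) \sweedler_(a', m' <- delta m0) F a a' m'.
Proof.
case: deltaP => hlin hassoc _ h1 h2 h3.
have bF a : bilin (F a) by apply: bilinP.
have bG : bilin (fun a (t : A ⊗ M) => tlift (F a) t).
  apply: bilinP => [t|a]; first by apply: linear_tlift_fun.
  exact: tlift_linear (bF a).
have hL := tlift_linear bG.
have := congr1 (tlift (fun a (t : A ⊗ M) => tlift (F a) t)) (hassoc m).
rewrite !(linear_fun_tlift _ _ hL) => h.
transitivity (\sweedler_(a, m0 <- delta m)
  tlift (fun a (t : A ⊗ M) => tlift (F a) t)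
    (\sweedler_(a1, a2 <- comul a) (a1 ⊙ (a2 ⊙ m0) : A ⊗ (A ⊗ M)))).
  apply: eq_tlift => a m0; rewrite (linear_fun_tlift _ _ hL).
  by apply: eq_tlift => a1 a2; rewrite !tlift_pure.
by rewrite h; apply: eq_tlift => a m0; rewrite tlift_pure.
Qed.

Lemma coaction_counit m : \sweedler_(a, m0 <- delta m) (counit a *: m0) = m.
Proof. by case: deltaP. Qed.

End Coaction.

Lemma tlift_tact (M N P V : lmodType K) (G : A -> P -> V) (f : M -> N -> P)
    (s : A ⊗ M) (t : A ⊗ N) : bilin G ->
  tlift G (tact f s t)
  = \sweedler_(a, m <- s) \sweedler_(b, n <- t) G (a * b) (f m n).
Proof.
move=> bG; have hL := tlift_linear bG.
rewrite /tact (linear_fun_tlift _ _ hL); apply: eq_tlift => a m.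
rewrite (linear_fun_tlift _ _ hL); apply: eq_tlift => b n.
by rewrite tlift_pure.
Qed.

Lemma tlift_tmapr (M N V : lmodType K) (G : A -> N -> V) (f : M -> N)
    (t : A ⊗ M) : bilin G ->
  tlift G (tmapr f t) = \sweedler_(a, m <- t) G a (f m).
Proof.
move=> bG; rewrite /tmapr (linear_fun_tlift _ _ (tlift_linear bG)).
by apply: eq_tlift => a m; rewrite tlift_pure.
Qed.

(** As maps on [A ⊗ A], [antip (a * b)] is a left and [antip b * antip a] a right convolution
    inverse of multiplication, so they agree. [F] is the product of all three, and its sum is
    contracted from either end. *)
Lemma antipM (a b : A) : antip (a * b) = antip b * antip a.
Proof.
have hA := comul_coaction A; have hS := @antip_linear _ A.
pose F (a1 a2 a3 b1 b2 b3 : A) : A :=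
  antip (a1 * b1) * (a2 * b2) * (antip b3 * antip a3).
transitivity (\sweedler_(a1, a' <- comul a) \sweedler_(a2, a3 <- comul a')
  \sweedler_(b1, b' <- comul b) \sweedler_(b2, b3 <- comul b')
  F a1 a2 a3 b1 b2 b3).
  (* The right counit axiom rewrites [a] and [b]. Both counits are then expanded by [antipr], that
     of [b'] between [a2] and [antip a3]. *)
  transitivity (\sweedler_(a1, a' <- comul a) \sweedler_(b1, b' <- comul b)
      antip ((counit a' *: a1) * (counit b' *: b1))).
    rewrite -{1}[a]comul_counitr -{1}[b]comul_counitr.
    rewrite (linear_fun_tlift (L := fun x : A =>
      antip (x * \sweedler_(b1, b' <- comul b) (counit b' *: b1))));
      last by lin.
    apply: eq_tlift => a1 a'.
    by rewrite (linear_fun_tlift (L := fun x : A =>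
      antip (counit a' *: a1 * x))); last by lin.
  apply: eq_tlift => a1 a'; rewrite exchange_tlift.
  apply: eq_tlift => b1 b'.
  transitivity (\sweedler_(a2, a3 <- comul a')
      (antip (a1 * b1) * (a2 * (counit b')%:A * antip a3))).
    transitivity (antip (a1 * b1) * ((counit b')%:A * (counit a')%:A)).
      by rewrite -scalerAl (linear_funZ _ _ hS) -scalerAr (linear_funZ _ _ hS)
        mulr_algl -[in RHS]scalerAr mulr_algr !scalerA mulrC.
    rewrite -(antipr a').
    rewrite (linear_fun_tlift (L := fun x : A =>
      antip (a1 * b1) * ((counit b')%:A * x))); last by lin.
    by apply: eq_tlift => a2 a3; rewrite mulr_algl mulr_algr scalerAl.
  apply: eq_tlift => a2 a3; rewrite -(antipr b').
  rewrite (linear_fun_tlift (L := fun x : A =>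
    antip (a1 * b1) * (a2 * x * antip a3))); last by lin.
  by apply: eq_tlift => b2 b3; rewrite /F !mulrA.
(* Coassociativity for [a] and for [b] regroups the legs, so that the first two come from one
   coproduct. *)
transitivity (\sweedler_(x, a3 <- comul a) \sweedler_(a1, a2 <- comul x)
  \sweedler_(y, b3 <- comul b) \sweedler_(b1, b2 <- comul y)
  F a1 a2 a3 b1 b2 b3).
  rewrite -(coaction_assoc hA (F := fun a1 a2 a3 =>
    \sweedler_(b1, b' <- comul b) \sweedler_(b2, b3 <- comul b')
      F a1 a2 a3 b1 b2 b3)) /F; [|by move=> *; lin..].
  apply: eq_tlift => x a3; apply: eq_tlift => a1 a2.
  by rewrite -(coaction_assoc hA (F := F a1 a2 a3)) /F; [|by move=> *; lin..].
(* As [comul] is multiplicative, [antip (a1 * b1) * (a2 * b2)] sums to the counit of [x * y] by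
   [antipl]. *)
transitivity (\sweedler_(x, a3 <- comul a) \sweedler_(y, b3 <- comul b)
    (counit (x * y) *: (antip b3 * antip a3))).
  apply: eq_tlift => x a3; rewrite exchange_tlift; apply: eq_tlift => y b3.
  rewrite -[RHS]mulr_algl -antipl comulM tlift_tact; last by lin.
  rewrite (linear_fun_tlift (L := fun z : A =>
    z * (antip b3 * antip a3))); last by lin.
  apply: eq_tlift => a1 a2.
  by rewrite (linear_fun_tlift (L := fun z : A =>
    z * (antip b3 * antip a3))); last by lin.
rewrite -{2}[a](coaction_counit hA) -{2}[b](coaction_counit hA).
rewrite (linear_fun_tlift (L := fun x : A => antip (\sweedler_(y, b3 <- comul b)
  (counit y *: b3)) * antip x)); last by lin.
apply: eq_tlift => x a3.
rewrite (linear_fun_tlift (L := fun z : A =>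
  antip z * antip (counit x *: a3))); last by lin.
apply: eq_tlift => y b3.
rewrite counitM !(linear_funZ _ _ hS).
by rewrite -[in RHS]scalerAl -[in RHS]scalerAr scalerA mulrC.
Qed.

(** The [A]-legs match by associativity of the product, the other legs by the third hypothesis. This
    gives both balancedness and the bimodule compatibility of the diagonal coaction. *)
Lemma tactA (M N P MN NP Q : lmodType K) (f : MN -> P -> Q) (g : M -> N -> MN)
    (f' : M -> NP -> Q) (g' : N -> P -> NP)
    (s : A ⊗ M) (t : A ⊗ N) (u : A ⊗ P) :
  (forall p, linear (f^~ p)) -> (forall m, linear (f' m)) ->
  (forall m n p, f (g m n) p = f' m (g' n p)) ->
  tact f (tact g s t) u = tact f' s (tact g' t u).
Proof.
move=> hf hf' h; rewrite /tact -/(tact g s t) -/(tact g' t u) tlift_tact; last first.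
  apply: bilinP => [m|a]; first by lin.
  apply: linear_tlift_fun => c p; apply: linear_purer; exact: hf.
apply: eq_tlift => a m; rewrite tlift_tact; last first.
  apply: bilinP => [m'|a']; first by lin.
  by apply: linear_purer; apply: hf'.
by apply: eq_tlift => b n; apply: eq_tlift => c p; rewrite mulrA h.
Qed.

(** * Tensor products over [B] and their classes modulo [B^+] *)

Section RelHopf.
Variable B : subComodAlg A.

Section BimodTensor.
Variables M N : bimod B.

Lemma bl_pure b (m : M) (n : N) : bl b (m ⊙ n : tensB M N) = bl b m ⊙ n.
Proof.
apply: (tlift_pure (f := fun m n => bl b m ⊙ n : tensB M N)).
split=> [n'|m'|m' c n']; [by lin | by lin |].
by rewrite blr pure_balance.
Qed.

Lemma br_pure b (m : M) (n : N) : br (m ⊙ n : tensB M N) b = m ⊙ br n b.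
Proof.
apply: (tlift_pure (f := fun m n => m ⊙ br n b : tensB M N)).
split=> [n'|m'|m' c n']; [by lin | by lin |].
by rewrite -blr pure_balance.
Qed.

Lemma in_BplusM_purel (m : M) (n : N) :
  in_BplusM m -> in_BplusM (m ⊙ n : tensB M N).
Proof.
move=> [s hs ->]; exists [seq (p.1, p.2 ⊙ n : tensB M N) | p <- s].
  by move=> _ /mapP[p ps ->]; apply: hs.
rewrite big_map (linear_fun_sum (f := fun m => m ⊙ n : tensB M N)); last by lin.
by apply: eq_bigr => p _; rewrite bl_pure.
Qed.

End BimodTensor.

Lemma cls_linear (M : bimod B) : linear (@cls _ _ _ M).
Proof. by move=> c m n; rewrite -cls_add -cls_scale. Qed.

Variables M N : relHopf B.
Local Notation pureMN := (fun m n => m ⊙ n : tensB M N).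

(** An element of [B^+] acting on [n] crosses the balanced tensor to act on [m] from the right, and
    [Bplus_comm] turns this into a left action. *)
Lemma in_BplusM_purer (m : M) (n : N) :
  in_BplusM n -> in_BplusM (m ⊙ n : tensB M N).
Proof.
move=> [s hs ->].
rewrite (linear_fun_sum (f := fun n => m ⊙ n : tensB M N)); last by lin.
rewrite big_seq; elim/big_ind: _ => [|u v|p ps]; [exact: BplusM0 | exact: BplusMD |].
rewrite -pure_balance; apply: in_BplusM_purel; apply/Bplus_comm.
exists [:: (m, p.1)]; last by rewrite big_seq1.
by move=> _ /[!inE] /eqP ->; apply: hs.
Qed.

(** This frees [Phi_tens], defined through chosen representatives, from that choice. *)
Lemma cls_pure (m m' : M) (n n' : N) : cls m = cls m' -> cls n = cls n' ->
  cls (m ⊙ n : tensB M N) = cls (m' ⊙ n' : tensB M N).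
Proof.
move=> /cls_eqP hm /cls_eqP hn; apply/cls_eqP.
have -> : (m ⊙ n : tensB M N) - m' ⊙ n' = (m - m') ⊙ n + m' ⊙ (n - n').
  rewrite (linear_funB (f := fun x => x ⊙ n : tensB M N)); last by lin.
  rewrite (linear_funB (f := fun x => m' ⊙ x : tensB M N)); last by lin.
  by rewrite addrA subrK.
by apply: BplusMD; [apply: in_BplusM_purel | apply: in_BplusM_purer].
Qed.

Lemma Phi_tens_pure (m : M) (n : N) :
  Phi_tens (cls m ⊙ cls n) = cls (m ⊙ n : tensB M N).
Proof.
rewrite /Phi_tens tlift_pure; first by apply: cls_pure; rewrite cls_repr.
have hl := @cls_linear (tensB M N).
apply: bilinP => [y|x] c u v.
  (* Choosing representatives is not linear, so linearity is proved on the module itself and carried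
     to classes by [cls_pure]. *)
  have h : linear (fun m : M => cls (m ⊙ repr y : tensB M N)) by lin.
  by rewrite -h; apply: cls_pure => //; rewrite cls_repr cls_linear !cls_repr.
have h : linear (fun n : N => cls (repr x ⊙ n : tensB M N)) by lin.
by rewrite -h; apply: cls_pure => //; rewrite cls_repr cls_linear !cls_repr.
Qed.

(** This makes [tens_coact] well defined on the tensor product over [B]. *)
Lemma tens_coact_balanced : balanced (@br _ _ M) (@bl _ _ N)
  (fun m n => tact pureMN (coact m) (coact n)).
Proof.
split=> [n|m|m b n]; [by rewrite /tact; lin | by rewrite /tact; lin |].
rewrite coact_br coact_bl; apply: tactA => [n'|m'|m' b' n']; [by lin | by lin |].
exact: pure_balance.
Qed.

Lemma tens_coact_linear : linear (@tens_coact _ _ _ M N).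
Proof. exact: tlift_linear tens_coact_balanced. Qed.

Lemma tens_coact_pure m n :
  tens_coact (pureMN m n) = tact pureMN (coact m) (coact n).
Proof. exact: tlift_pure tens_coact_balanced. Qed.

End RelHopf.

(** * The diagonal coaction as a compatible coaction *)

Section Diagonal.
Variable B : subComodAlg A.
Variables M N : relHopf B.
Local Notation pureMN := (fun m n => m ⊙ n : tensB M N).

Lemma tens_coact_bl b (t : tensB M N) :
  tens_coact (bl b t) = tact (@bl _ _ (tensB M N)) (coactL b) (tens_coact t).
Proof.
have hl := @tens_coact_linear _ M N.
move: t; apply: eq_linear_tens => [||m n]; [by lin | by rewrite /tact; lin |].
rewrite bl_pure !tens_coact_pure coact_bl.
apply: tactA => [n'|b'|b' m' n']; [by lin | by lin |].
by rewrite bl_pure.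
Qed.

Lemma tens_coact_br b (t : tensB M N) :
  tens_coact (br t b) = tact (@br _ _ (tensB M N)) (tens_coact t) (coactL b).
Proof.
have hl := @tens_coact_linear _ M N.
move: t; apply: eq_linear_tens => [||m n]; [by lin | by rewrite /tact; lin |].
rewrite br_pure !tens_coact_pure coact_br.
apply/esym; apply: tactA => [b'|m'|m' n' b']; [by lin | by lin |].
by rewrite br_pure.
Qed.

Lemma tens_coactP : is_coaction (@tens_coact _ _ _ M N).
Proof.
have hl := @tens_coact_linear _ M N.
split=> //.
- apply: eq_linear_tens => [||m n]; [by lin | by lin |].
  rewrite tens_coact_pure tlift_tact; last by lin.
  rewrite tlift_tact; last by lin.
  pose F (a1 a2 : A) (m' : M) (b1 b2 : A) (n' : N) :=
    (a1 * b1) ⊙ ((a2 * b2) ⊙ (m' ⊙ n' : tensB M N) : A ⊗ tensB M N)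
      : A ⊗ (A ⊗ tensB M N).
  (* Both sides are sums of [F]; coassociativity is used first in [M], then in [N]. *)
  transitivity (\sweedler_(a, m0 <- coact m) \sweedler_(a1, a2 <- comul a)
    \sweedler_(b, n0 <- coact n) \sweedler_(b1, b2 <- comul b)
      F a1 a2 m0 b1 b2 n0).
    apply: eq_tlift => a m0; rewrite exchange_tlift; apply: eq_tlift => b n0.
    by rewrite comulM tlift_tact //; lin.
  rewrite (coaction_assoc (coactP M) (F := fun a1 a2 m0 =>
    \sweedler_(b, n0 <- coact n) \sweedler_(b1, b2 <- comul b)
      F a1 a2 m0 b1 b2 n0)) /F; [|by move=> *; lin..].
  apply: eq_tlift => a m0.
  transitivity (\sweedler_(a', m' <- coact m0) \sweedler_(b, n0 <- coact n)
    \sweedler_(b', n' <- coact n0) F a a' m' b b' n').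
    apply: eq_tlift => a' m'.
    rewrite (coaction_assoc (coactP N) (F := F a a' m')) /F //;
      by move=> *; lin.
  rewrite exchange_tlift; apply: eq_tlift => b n0.
  rewrite tens_coact_pure.
  rewrite /tact (linear_fun_tlift (L := fun t : A ⊗ tensB M N =>
    (a * b) ⊙ t : A ⊗ (A ⊗ tensB M N))); last by lin.
  apply: eq_tlift => a' m'.
  by rewrite (linear_fun_tlift (L := fun t : A ⊗ tensB M N =>
    (a * b) ⊙ t : A ⊗ (A ⊗ tensB M N))); last by lin.
- apply: eq_linear_tens => [||m n]; [by lin | by lin |].
  rewrite tens_coact_pure tlift_tact; last by lin.
  (* The counit is multiplicative, so each of its two factors restores its own tensor factor. *)
  rewrite -{2}[m](coaction_counit (coactP M)) -{2}[n](coaction_counit (coactP N)).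
  rewrite (linear_fun_tlift (L := fun m' : M =>
    m' ⊙ _ : tensB M N)); last by lin.
  apply: eq_tlift => a m0.
  rewrite (linear_fun_tlift (L := fun n' : N =>
    (counit a *: m0) ⊙ n' : tensB M N)); last by lin.
  apply: eq_tlift => b n0.
  rewrite counitM -scalerA.
  rewrite (linear_funZ (f := fun m' : M =>
    m' ⊙ (counit b *: n0) : tensB M N)); last by lin.
  by rewrite (linear_funZ (f := fun n' : N =>
    m0 ⊙ n' : tensB M N)); last by lin.
Qed.

End Diagonal.

(** * The untwisting map *)

Section Untwist.
Variables (B : subComodAlg A) (M : bimod B) (delta : M -> A ⊗ M).
Hypothesis deltaP : is_coaction delta.
Hypothesis delta_bl : forall b m,
  delta (bl b m) = tact (@bl _ _ M) (coactL b) (delta m).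

Definition untwist (a : A) (m : M) : tensAB M :=
  \sweedler_(x, m0 <- delta m) ((a * antip x) ⊙ m0 : tensAB M).

Lemma untwist_linear a : linear (untwist a).
Proof. by case: deltaP => hl _ _; rewrite /untwist; lin. Qed.

(** Since the antipode reverses products, [antip] of the first leg of [b] ends up next to the tensor
    sign. The second leg crosses it and meets the first, and their product sums to the counit. *)
Lemma untwist_bl a b m : untwist a (bl b m) = augm b *: untwist a m.
Proof.
rewrite /untwist delta_bl tlift_tact; last by lin.
rewrite exchange_tlift (linear_fun_tlift (L := fun t : tensAB M =>
  augm b *: t)); last by lin.
apply: eq_tlift => x m0.
have hL : linear (fun z : A => (a * antip x * z) ⊙ m0 : tensAB M) by lin.
rewrite -(linear_funZ (f := fun z : A => z ⊙ m0 : tensAB M)); last by lin.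
(* The scalar is expanded along the coproduct of [incl b], which [incl_coact] identifies with the
   coaction of [b]. *)
rewrite -mulr_algr -antipl -incl_coact tlift_tmapr; last by lin.
rewrite (linear_fun_tlift _ _ hL).
apply: eq_tlift => y b2.
by rewrite -pure_balance antipM /rmulB !mulrA.
Qed.

Lemma untwist_cls a m m' : cls m = cls m' -> untwist a m = untwist a m'.
Proof.
move=> /cls_eqP[s hs hm]; apply/eqP; rewrite -subr_eq0.
rewrite -(linear_funB _ _ (untwist_linear a)) hm.
rewrite (linear_fun_sum _ _ (untwist_linear a)) big_seq big1 // => p ps.
by rewrite untwist_bl hs // scale0r.
Qed.

(** By coassociativity the coefficient becomes [a1 * antip a2] over one coproduct, which [antipr]
    collapses; the counit axiom then restores [m]. *)
Lemma untwistK m : \sweedler_(a, m0 <- delta m) untwist a m0 = 1 ⊙ m.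
Proof.
rewrite /untwist -(coaction_assoc deltaP
  (F := fun a1 a2 m0 => (a1 * antip a2) ⊙ m0 : tensAB M)); [|by move=> *; lin..].
rewrite -{2}[m](coaction_counit deltaP).
rewrite (linear_fun_tlift (L := fun m' : M => 1 ⊙ m' : tensAB M)); last by lin.
apply: eq_tlift => a m0.
rewrite -(linear_fun_tlift (L := fun z : A => z ⊙ m0 : tensAB M)); last by lin.
rewrite antipr (linear_funZ (f := fun z : A => z ⊙ m0 : tensAB M)); last by lin.
by rewrite (linear_funZ (f := fun m' : M => 1 ⊙ m' : tensAB M)); last by lin.
Qed.

End Untwist.

(** * Covariant bimodule connections and the formula for [sigma] *)

Section BimoduleConnection.
Variables (B : subComodAlg A) (Om F : relHopf B) (d : B -> Om).
Hypotheses (d_fodc : is_fodc d) (d_cov : covariant_fodc d (@coact _ _ _ Om)).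

Lemma coact_d b : coact (d b) = tmapr d (coactL b).
Proof.
case: d_fodc d_cov => hd _ _ [_ hcov].
(* Covariance concerns products [bl b (d c)]; the case needed here has left factor 1, whose coaction
   is trivial. *)
rewrite -[d b]bl1 hcov coactL1 /tact tlift_pure; last by lin.
by apply: eq_tlift => a b'; rewrite mul1r bl1.
Qed.

Variables (nabla : F -> tensB Om F) (sigma : tensB F Om -> tensB Om F).
Hypothesis nabla_cov : covariant_connection d nabla.
Hypothesis sigmaP : is_associated_bimod_map d nabla sigma.

(** On such elements [sigma] is the difference of [nabla (br f b)] and [br (nabla f) b], and both
    are colinear in [f] and [b] because [nabla] is. *)
Lemma tens_coact_sigma f b :
  tens_coact (sigma (f ⊙ d b))
  = tact (fun f b => sigma (f ⊙ d b)) (coact f) (coactL b).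
Proof.
case: nabla_cov sigmaP => [[hn _] hcov] [_ hs].
rewrite hs (linear_funB _ _ (@tens_coact_linear _ Om F)) hcov tens_coact_br hcov.
have -> : tmapr nabla (coact (br f b))
    = tact (fun f b => nabla (br f b)) (coact f) (coactL b).
  by rewrite coact_br /tmapr tlift_tact //; lin.
have -> : tact (@br _ _ (tensB Om F)) (tmapr nabla (coact f)) (coactL b)
    = tact (fun f b => br (nabla f) b) (coact f) (coactL b).
  by rewrite /tact tlift_tmapr //; lin.
(* All the sums run over the same representatives of [coact f] and [coactL b], so they are
   subtracted term by term. *)
rewrite /tact /tlift /sum_over -sumrB; apply: eq_bigr => p _.
rewrite -sumrB; apply: eq_bigr => p' _.
rewrite hs -(linear_funB
  (f := fun t : tensB Om F => (p.1 * p'.1) ⊙ t : A ⊗ tensB Om F)) //.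
by lin.
Qed.

Variable c : K.
Hypothesis Phi_sigma : forall e w,
  Phi_map sigma (Phi_tens (cls e ⊙ cls w)) = c *: Phi_tens (cls w ⊙ cls e).

Lemma cls_sigma e w : cls (sigma (e ⊙ w)) = cls (c *: (w ⊙ e : tensB Om F)).
Proof.
case: sigmaP => [[hl hbl _] _].
(* [Phi_map] evaluates [sigma] at a chosen representative; the choice is immaterial because [sigma],
   being left [B]-linear, preserves the multiples of [B^+]. *)
have -> : cls (sigma (e ⊙ w)) = Phi_map sigma (cls (e ⊙ w : tensB F Om)).
  apply/cls_eqP; rewrite -(linear_funB _ _ hl).
  have /cls_eqP[s hs ->] : cls (e ⊙ w : tensB F Om)
      = cls (repr (cls (e ⊙ w : tensB F Om))).
    by rewrite cls_repr.
  exists [seq (p.1, sigma p.2) | p <- s].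
    by move=> _ /mapP[p ps ->]; apply: hs.
  by rewrite (linear_fun_sum _ _ hl) big_map; apply: eq_bigr => p _; rewrite hbl.
rewrite -Phi_tens_pure Phi_sigma Phi_tens_pure.
by rewrite (linear_funZ _ _ (@cls_linear _ (tensB Om F))).
Qed.

(** The scalar [c] stands for the power of theta, and [F] for the relative line module. *)
Lemma sigma_formula b e :
  (1 ⊙ sigma (e ⊙ d b) : tensAB (tensB Om F))
  = c *: \sweedler_(e2, e' <- coact2 (@coact _ _ _ F) e)
         \sweedler_(e1, e0 <- e')
         \sweedler_(b1, b' <- coact2 (@coactL _ _ B) b)
         \sweedler_(b2, b3 <- b')
           ((e2 * b1 * antip e1 * antip b2) ⊙ (d b3 ⊙ e0)
              : tensAB (tensB Om F)).
Proof.
case: (d_fodc) => hd _ _.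
have hT := @tens_coactP _ Om F; have hTl := @tens_coact_linear _ Om F.
rewrite -(untwistK hT) tens_coact_sigma tlift_tact; last first.
  by rewrite /untwist; lin.
rewrite /coact2 tlift_tmapr; last by lin.
rewrite (linear_fun_tlift (L := fun t : tensAB (tensB Om F) =>
  c *: t)); last by lin.
apply: eq_tlift => e2 e'.
transitivity (\sweedler_(b1, b' <- coactL b) \sweedler_(b2, b3 <- coactL b')
    \sweedler_(e1, e0 <- coact e')
      (c *: ((e2 * b1 * antip e1 * antip b2) ⊙ (d b3 ⊙ e0)
         : tensAB (tensB Om F)))).
  apply: eq_tlift => b1 b'.
  (* Only the class of [sigma] enters, so it is replaced by [c] times the flip. Untwisting the flip
     yields [antip (b2 * e1)], which [antipM] turns into the order of the formula. *)
  rewrite (untwist_cls hT (@tens_coact_bl _ Om F) _ (cls_sigma _ _)).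
  rewrite (linear_funZ _ _ (untwist_linear hT _)) /untwist tens_coact_pure.
  rewrite tlift_tact; last by lin.
  rewrite coact_d tlift_tmapr; last by lin.
  rewrite (linear_fun_tlift (L := fun t : tensAB (tensB Om F) =>
    c *: t)); last by lin.
  apply: eq_tlift => b2 b3.
  rewrite (linear_fun_tlift (L := fun t : tensAB (tensB Om F) =>
    c *: t)); last by lin.
  by apply: eq_tlift => e1 e0; rewrite antipM !mulrA.
(* It remains to pull out [c] and reorder the sums, as the formula expands [e] completely before
   [b]. *)
rewrite (linear_fun_tlift (L := fun t : tensAB (tensB Om F) =>
  c *: t)); last by lin.
under eq_tlift => b1 b' do rewrite exchange_tlift.
rewrite exchange_tlift; apply: eq_tlift => e1 e0.
rewrite tlift_tmapr; last by lin.
rewrite (linear_fun_tlift (L := fun t : tensAB (tensB Om F) =>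
  c *: t)); last by lin.
apply: eq_tlift => b1 b'.
by rewrite (linear_fun_tlift (L := fun t : tensAB (tensB Om F) =>
  c *: t)); last by lin.
Qed.

End BimoduleConnection.

End HopfModules.

(** * The formula for relative line modules over the flag manifold *)

Theorem proposition4p7 (R : realType) (q : R)
    (hq : [&& q != -1, q != 0 & q != 1])
    (g : simpleLie R[i]) (D : rootDatum g)
    (x : 'I_(rk D)) (hx : cominuscule x)
    (U : quantumGroup q D) (A : coordAlg U) (V : fundModule U x)
    (B : subComodAlg A) (hB : is_flag_manifold x B)
    (P : subComodAlg A) (hP : is_Poisson_space x P)
    (Om : relHopf B) (db : B -> Om) (hOm : is_HK01 V P db)
    (E : int -> relHopf B) (iota : forall k, E k -> A)
    (hE : forall k, is_relative_line V k (iota k))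
    (nabla : forall k, E k -> tensB Om (E k))
    (hnabla : forall k, covariant_connection db (nabla k))
    (sigma : forall k, tensB (E k) Om -> tensB Om (E k))
    (hsigma : forall k, is_associated_bimod_map db (nabla k) (sigma k))
    (theta : R[i]) (htheta0 : theta != 0)
    (htheta : forall k (e : E k) (w : Om),
       Phi_map (sigma k) (Phi_tens (cls e ⊙ cls w))
       = theta ^ k *: Phi_tens (cls w ⊙ cls e))
    (k : int) (b : B) (e : E k) :
  (1 ⊙ sigma k (e ⊙ db b) : tensAB (tensB Om (E k)))
  = theta ^ k *:
    \sweedler_(e2, e' <- coact2 (@coact _ _ _ (E k)) e)
    \sweedler_(e1, e0 <- e')
    \sweedler_(b1, b' <- coact2 (@coactL _ _ B) b)
    \sweedler_(b2, b3 <- b')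
      ((e2 * b1 * antip e1 * antip b2) ⊙ (db b3 ⊙ e0)
         : tensAB (tensB Om (E k))).
Proof.
case: hOm => d_fodc d_cov _ _ _.
exact: (sigma_formula d_fodc d_cov (hnabla k) (hsigma k) (htheta k)).
Qed.
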